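(* Let $X$ be a metric space with $X=\bigcup_{i\in I}X_i$, let $E$ be a Banach space, and let $1\le p<+\infty$. Suppose that for every $s>0$ there is a bounded set $C_s\subseteq X$ such that $X_i\cap C_s\neq\emptyset$ for every $i\in I$ and the sets $\{X_i\setminus C_s\}_{i\in I}$ are $s$-separated. If the family $\{X_i\}_{i\in I}$ (with the restricted metrics) is equivalently coarsely embedded into $E$, then $X$ admits a coarse embedding into $E^p$.
   Context: A family of subsets $\{A_i\}_{i\in I}$ of a metric space is $s$-separated if $d(A_i,A_j)=\inf\{d(a,b) : a\in A_i,\ b\in A_j\}\ge s$ for all $i\ne j$ (the infimum of the empty set is $+\infty$). A family of metric spaces $\{X_i\}_{i\in I}$ is equivalently coarsely embedded into a metric space $Y$ if there exist maps $f_i:X_i\to Y$ such that: (1) for every $s\ge 0$ there is $S\ge 0$ such that for all $i\in I$ and $x,x'\in X_i$, $d(x,x')\le s$ implies $d(f_i(x),f_i(x'))\le S$; (2) for every $r\ge 0$ there is $R\ge 0$ such that for all $i\in I$ and $x,x'\in X_i$, $d(f_i(x),f_i(x'))\le r$ implies $d(x,x')\le R$. A map $f:X\to Y$ is a coarse embedding if it satisfies (1) and (2) as a one-member family; $X$ admits a coarse embedding into $Y$ if such an $f$ exists. For a Banach space $E$ and $1\le p<+\infty$, $E^p=\{x=(x_i)_{i\in\mathbb{N}} : x_i\in E,\ \sum_{i\in\mathbb{N}}\|x_i\|^p<+\infty\}$ with norm $\|x\|=(\sum_{i\in\mathbb{N}}\|x_i\|^p)^{1/p}$.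
   Formalization: The index set I is assumed countable; for uncountable I the claim fails, e.g. for uncountably many rays [0,∞) glued at 0 with E = ℝ, since E^p = ℓ^p(ℕ) is separable. *)

(* Defs.v *)
From HB Require Import structures.
From mathcomp Require Import all_boot all_order all_algebra.
From mathcomp Require Import all_classical all_reals all_analysis.

Set Implicit Arguments.
Unset Strict Implicit.
Unset Printing Implicit Defensive.

Import Order.TTheory GRing.Theory Num.Theory.
Import numFieldNormedType.Exports.

Local Open Scope classical_set_scope.
Local Open Scope ring_scope.

(* The library already gives [set_type A] the restricted pseudometric. *)
Section restricted_metric.
Context {R : realType} {X : metricType R} (A : set X).

Let d (x y : A) : R := mdist (set_val x) (set_val y).

Let d_ge0 x y : 0 <= d x y.
Proof. exact: mdist_ge0. Qed.

Let d_eq0 x y : d x y = 0 -> x = y.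
Proof. by move=> /mdist_positivity; exact: val_inj. Qed.

Let ball_d (x : A) (e : R) : ball x e = [set y | d x y < e].
Proof.
rewrite /d [LHS](_ : _ = set_val @^-1` ball (set_val x) e) //.
by rewrite ballEmdist.
Qed.

HB.instance Definition _ :=
  @PseudoMetric_isMetric.Build R (set_type A) d d_ge0 d_eq0 ball_d.

End restricted_metric.

(* [normedModType] does not inherit from [metricType], hence this alias. *)
Definition norm_metric (R : realType) (E : normedModType R) : Type := E.

Section norm_metric.
Context {R : realType} (E : normedModType R).

HB.instance Definition _ := PseudoMetric.copy (norm_metric E) E.

Let d (x y : norm_metric E) : R := `|(x : E) - (y : E)|.

Let d_ge0 x y : 0 <= d x y.
Proof. exact: normr_ge0. Qed.

Let d_eq0 x y : d x y = 0 -> x = y.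
Proof. by move=> /normr0_eq0/subr0_eq. Qed.

Let ball_d (x : norm_metric E) (e : R) : ball x e = [set y | d x y < e].
Proof. by rewrite -[LHS]/(ball (x : E) e) -ball_normE. Qed.

HB.instance Definition _ :=
  @PseudoMetric_isMetric.Build R (norm_metric E) d d_ge0 d_eq0 ball_d.

End norm_metric.

Section coarse.
Context {R : realType}.

Definition metric_bounded (X : metricType R) (C : set X) : Prop :=
  exists M : R, forall x y, C x -> C y -> mdist x y <= M.

Definition set_dist (X : metricType R) (A B : set X) : \bar R :=
  ereal_inf [set (mdist a b)%:E | a in A & b in B].

Definition separated_family (X : metricType R) (I : Type) (s : R)
    (A : I -> set X) : Prop :=
  forall i j, i <> j -> (s%:E <= set_dist (A i) (A j))%E.

Definition equi_coarse_embedding (I : Type) (X : I -> metricType R)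
    (Y : metricType R) (f : forall i, X i -> Y) : Prop :=
  (forall s : R, 0 <= s -> exists2 S : R, 0 <= S &
     forall i (x x' : X i), mdist x x' <= s -> mdist (f i x) (f i x') <= S) /\
  (forall r : R, 0 <= r -> exists2 R' : R, 0 <= R' &
     forall i (x x' : X i), mdist (f i x) (f i x') <= r -> mdist x x' <= R').

Definition equi_coarsely_embedded (I : Type) (X : I -> metricType R)
    (Y : metricType R) : Prop :=
  exists f : forall i, X i -> Y, equi_coarse_embedding f.

Definition coarse_embedding (X Y : metricType R) (f : X -> Y) : Prop :=
  equi_coarse_embedding (fun _ : unit => f).

Definition coarsely_embeds (X Y : metricType R) : Prop :=
  exists f : X -> Y, coarse_embedding f.

End coarse.

Section power_space.
Context {R : realType} (E : normedModType R) (p : R).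

Definition psum (x : nat -> E) : \bar R :=
  (\sum_(0 <= i <oo) (`|x i| `^ p)%:E)%E.

Definition pnorm (x : nat -> E) : R := fine (psum x) `^ p^-1.

(* The (unused) argument lets canonical structure inference find the closure
   properties, which depend on it. *)
Definition psummable (p1 : 1 <= p) : {pred nat -> E} :=
  fun x => (psum x < +oo)%E.

Record pspace (p1 : 1 <= p) : Type := PSpace {
  pspace_val :> nat -> E;
  pspaceP : pspace_val \in psummable p1 }.

End power_space.

Section power_space_theory.
Context {R : realType} {E : normedModType R} {p : R} (p1 : 1 <= p).
Implicit Types x y : nat -> E.

Let p0 : 0 < p. Proof. exact: lt_le_trans p1. Qed.

Lemma psum_ge0 x : (0 <= psum p x)%E.
Proof. by apply: nneseries_ge0 => i _ _; rewrite lee_fin powR_ge0. Qed.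

Let N (f : nat -> R) : \bar R := 'N[@counting nat R]_p%:E [EFin \o f]%E.

Let NE (f : nat -> R) :
  N f = ((\sum_(0 <= i <oo) (`|f i| `^ p)%:E) `^ p^-1)%E.
Proof. by rewrite /N Lnorm_counting. Qed.

Let psumE x : (psum p x `^ p^-1)%E = N (fun i => `|x i|).
Proof.
by rewrite NE; congr (_ `^ _)%E; apply: eq_eseriesr => i _; rewrite normr_id.
Qed.

Let le_poweR_pV a b : (0 <= a -> a <= b -> a `^ p^-1 <= b `^ p^-1)%E.
Proof.
move=> a0 ab; have b0 := le_trans a0 ab.
by apply: gt0_ler_poweR; rewrite ?invr_ge0 ?(ltW p0)// in_itv/= ?andbT ?leey ?a0 ?b0.
Qed.

Let N_triangle x y :
  (psum p (x + y)%R `^ p^-1 <= psum p x `^ p^-1 + psum p y `^ p^-1)%E.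
Proof.
rewrite !psumE.
apply: (@le_trans _ _ (N (fun i => `|x i| + `|y i|))).
  rewrite -psumE NE; apply: le_poweR_pV; first exact: psum_ge0.
  apply: lee_nneseries => i _; first by rewrite lee_fin powR_ge0.
  rewrite lee_fin ge0_ler_powR ?nnegrE ?(ltW p0)//.
  by rewrite (le_trans (ler_normD _ _))// ler_norm.
have := @minkowski_EFin _ _ R (@counting nat R)
  (fun i => `|x i|) (fun i => `|y i|) p.
exact.
Qed.

Let psum_lty x : (psum p x < +oo)%E = (psum p x `^ p^-1 < +oo)%E.
Proof.
apply/idP/idP => [|h]; first exact: poweR_lty.
by apply: lty_poweRy h; rewrite gt_eqF// invr_gt0.
Qed.

Lemma psumZ (a : R) x : psum p (a *: x) = ((`|a| `^ p)%:E * psum p x)%E.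
Proof.
rewrite /psum -nneseriesZl; last by move=> i _; rewrite lee_fin powR_ge0.
by apply: eq_eseriesr => i _; rewrite -EFinM /= normrZ powRM.
Qed.

Lemma psummable_submod_closed : submod_closed (psummable (E := E) p1).
Proof.
split=> [|a x y].
  rewrite unfold_in /psummable /psum eseries0 ?ltry// => i _ _ /=.
  by rewrite normr0 powR0// gt_eqF.
rewrite !unfold_in /psummable => xoo yoo; rewrite psum_lty.
apply: (le_lt_trans (N_triangle _ _)).
rewrite lte_add_pinfty -?psum_lty// psumZ lte_mul_pinfty ?lee_fin ?powR_ge0//.
Qed.

HB.instance Definition _ :=
  GRing.isSubmodClosed.Build R (nat -> E) (psummable p1) psummable_submod_closed.

HB.instance Definition _ := [isSub for @pspace_val R E p p1].
HB.instance Definition _ := [Choice of pspace E p1 by <:].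
HB.instance Definition _ :=
  [SubChoice_isSubLmodule of pspace E p1 by <:].

Let pnormE x : x \in psummable p1 -> (pnorm p x)%:E = (psum p x `^ p^-1)%E.
Proof.
by move=> xoo; rewrite /pnorm -poweR_EFin fineK// ge0_fin_numE ?psum_ge0.
Qed.

Let seq_pnormD x y : x \in psummable p1 -> y \in psummable p1 ->
  pnorm p (x + y) <= pnorm p x + pnorm p y.
Proof.
move=> xoo yoo; rewrite -lee_fin EFinD [leLHS]pnormE ?rpredD//.
rewrite [X in (_ <= X + _)%E]pnormE// [X in (_ <= _ + X)%E]pnormE//.
Qed.

Lemma pspaceD (x y : pspace E p1) :
  (x + y : pspace E p1) = (x : nat -> E) + (y : nat -> E) :> (nat -> E).
Proof. exact: (raddfD (val : pspace E p1 -> (nat -> E))). Qed.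

Lemma pspaceZ (a : R) (x : pspace E p1) :
  (a *: x : pspace E p1) = a *: (x : nat -> E) :> (nat -> E).
Proof. by rewrite -[LHS]/(val (a *: x)) linearZ. Qed.

Let pnormD (x y : pspace E p1) : pnorm p (x + y) <= pnorm p x + pnorm p y.
Proof. by rewrite pspaceD; exact: seq_pnormD (pspaceP x) (pspaceP y). Qed.

Let pnormZ (a : R) (x : pspace E p1) : pnorm p (a *: x) = `|a| * pnorm p x.
Proof.
have xfin : psum p x \is a fin_num.
  by rewrite ge0_fin_numE ?psum_ge0//; exact: pspaceP.
rewrite pspaceZ /pnorm psumZ fineM// powRM ?powR_ge0 ?fine_ge0 ?psum_ge0//=.
by rewrite -powRrM mulfV ?gt_eqF// powRr1.
Qed.

Let pnorm0_eq0 (x : pspace E p1) : pnorm p x = 0 -> x = 0.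
Proof.
move=> /eqP; rewrite powR_eq0 => /andP[/eqP x0 _]; apply: val_inj.
have {}x0 : psum p x = 0%E.
  rewrite -[LHS]fineK ?x0// ge0_fin_numE ?psum_ge0//; exact: pspaceP.
apply/funext => i; apply/normr0_eq0/(@powR_eq0_eq0 _ _ p).
have h k : true -> (0 <= (`|(x : nat -> E) k| `^ p)%:E)%E.
  by rewrite lee_fin powR_ge0.
apply/le_anti/andP; split; last exact: powR_ge0.
rewrite -lee_fin -[leRHS]x0 /psum.
rewrite (@nneseriesD1 _ _ i xpredT h)// leeDl// nneseries_ge0// => k _ _; exact: h.
Qed.

HB.instance Definition _ :=
  Lmodule_isNormed.Build R (pspace E p1) pnormD pnormZ pnorm0_eq0.

Lemma pspace_normE (x : pspace E p1) :
  `|x| = fine (\sum_(0 <= i <oo) (`|x i| `^ p)%:E)%E `^ p^-1.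
Proof. by []. Qed.

End power_space_theory.

(* Main.v *)
Require Import Defs.
From HB Require Import structures.
From mathcomp Require Import all_boot all_order all_algebra.
From mathcomp Require Import all_classical all_reals all_analysis.
Import Order.TTheory GRing.Theory Num.Theory.
Import numFieldNormedType.Exports.
Local Open Scope classical_set_scope.
Local Open Scope ring_scope.

(** Different pieces are put on different coordinates. Let [B] be the bounded
    set given by the separation hypothesis at scale [1], choose [b i] in
    [A i `&` B] for each [i], and translate the given embedding of [A i] so
    that it vanishes at [b i]; call it [h i]. Choose also a piece [A (idx x)]
    containing each point [x], and an injection [g] of the index set into
    [nat]. The coarse embedding sends [x] to the sequence whose only nonzero
    entry is [h (idx x) x], at position [g (idx x)].

    Two points with the same index are compared inside one piece, where the
    family is equivalently coarsely embedded. For different indices: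
    - if [x] and [x'] are at distance at most [s], separation at scale [s + 1]
      forces one of them into a bounded set, so both are at bounded distance
      from the base points of their pieces ([switch_near_base]); hence
      [h (idx x) x] and [h (idx x') x'] have bounded norm;
    - if the images are at distance at most [r], reading off two coordinates
      ([ler_norm_coord]) bounds the norms of [h (idx x) x] and
      [h (idx x') x'] by [r]; so [x] and [x'] are at bounded distance from
      base points, and all base points lie in the bounded set [B]. *)

Lemma metric_boundedU (R : realType) (X : metricType R) (C D : set X) :
  metric_bounded C -> metric_bounded D -> metric_bounded (C `|` D).
Proof.
move=> [M MC] [N ND].
have [->|/set0P[c Cc]] := eqVneq C set0; first by rewrite set0U; exists N.
have [->|/set0P[d Dd]] := eqVneq D set0; first by rewrite setU0; exists M.
have CD x y : C x -> D y -> mdist x y <= M + mdist c d + N.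
  move=> Cx Dy; rewrite (le_trans (metric_triangle x d y))// lerD ?ND//.
  by rewrite (le_trans (metric_triangle x c d))// lerD ?MC.
have M0 : 0 <= M by rewrite (le_trans (mdist_ge0 c c))// MC.
have N0 : 0 <= N by rewrite (le_trans (mdist_ge0 d d))// ND.
have cd0 := mdist_ge0 c d.
exists (M + mdist c d + N) => x y [Cx|Dx] [Cy|Dy].
- by rewrite (le_trans (MC _ _ Cx Cy))// -addrA lerDl addr_ge0.
- exact: CD.
- by rewrite metric_sym CD.
- by rewrite (le_trans (ND _ _ Dx Dy))// lerDr addr_ge0.
Qed.

Section single.
Context {R : realType} {E : normedModType R} {p : R} (p1 : 1 <= p).

Let p0 : 0 < p. Proof. exact: lt_le_trans p1. Qed.

Let powRpV (a : R) : 0 <= a -> (a `^ p) `^ p^-1 = a.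
Proof. by move=> a0; rewrite -powRrM mulfV ?gt_eqF// powRr1. Qed.

Lemma ler_norm_coord (x : pspace E p1) (n : nat) :
  `|(x : nat -> E) n| <= `|x|.
Proof.
rewrite -[leLHS]powRpV// pspace_normE -/(psum p x).
have term0 k : true -> (0 <= (`|(x : nat -> E) k| `^ p)%:E)%E.
  by rewrite lee_fin powR_ge0.
rewrite ge0_ler_powR ?nnegrE ?invr_ge0 ?powR_ge0 ?fine_ge0 ?psum_ge0 ?(ltW p0)//.
rewrite -lee_fin fineK; last first.
  by rewrite ge0_fin_numE ?psum_ge0//; exact: pspaceP.
by rewrite /psum (@nneseriesD1 _ _ n xpredT term0)// leeDl// nneseries_ge0.
Qed.

Definition single_seq (n : nat) (v : E) : nat -> E :=
  fun k => if k == n then v else 0.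

Lemma psum_single (n : nat) (v : E) :
  psum p (single_seq n v) = (`|v| `^ p)%:E.
Proof.
rewrite /psum (@nneseriesD1 _ _ n xpredT); last 2 first.
- by move=> k _; rewrite lee_fin powR_ge0.
- by [].
rewrite {1}/single_seq eqxx eseries0 ?adde0// => k _ /= /negPf kn.
by rewrite /single_seq kn normr0 powR0// gt_eqF.
Qed.

Lemma single_summable (n : nat) (v : E) : single_seq n v \in psummable p1.
Proof. by rewrite unfold_in /psummable psum_single ltry. Qed.

Definition single (n : nat) (v : E) : pspace E p1 :=
  PSpace (single_summable n v).

Lemma norm_single (n : nat) (v : E) : `|single n v| = `|v|.
Proof. by rewrite pspace_normE -/(psum p _) psum_single /= powRpV. Qed.

Lemma pspace_subE (x y : pspace E p1) (k : nat) :
  (x - y : pspace E p1) k = (x : nat -> E) k - (y : nat -> E) k.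
Proof. by rewrite pspaceD -scaleN1r pspaceZ scaleN1r. Qed.

Lemma single_sub (n : nat) (v w : E) :
  single n v - single n w = single n (v - w).
Proof.
apply: val_inj; apply/funext => k; rewrite [LHS]pspace_subE /= /single_seq.
by case: ifP; rewrite ?subr0.
Qed.

End single.

(** Extending each map by zero outside its piece makes all of them functions
    on the whole of [X], so that the pieces containing two given points can be
    identified without transporting along an equality of indices. *)
Lemma equi_coarsely_embedded_total (R : realType) (X : metricType R) (I : Type)
    (A : I -> set X) (E : normedModType R) :
  equi_coarsely_embedded (fun i => set_type (A i)) (norm_metric E) ->
  exists f : I -> X -> E,
    (forall s : R, 0 <= s -> exists2 S : R, 0 <= S & forall i x x',
       A i x -> A i x' -> mdist x x' <= s -> `|f i x - f i x'| <= S) /\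
    (forall r : R, 0 <= r -> exists2 S : R, 0 <= S & forall i x x',
       A i x -> A i x' -> `|f i x - f i x'| <= r -> mdist x x' <= S).
Proof.
move=> [f [f_up f_lo]].
pose f' i x : E := if pselect (A i x) is left Ax
  then f i (exist _ x (mem_set Ax)) else 0.
exists f'; split=> [s /f_up|r /f_lo] [S S0 fS]; exists S => // i x x' Ax Ax';
  rewrite /f'; case: pselect => // {}Ax; case: pselect => // {}Ax' ?;
  exact: (fS i (exist _ x (mem_set Ax)) (exist _ x' (mem_set Ax'))).
Qed.

(** Separation at a scale above [s] leaves no jump of length at most [s]
    between two pieces outside the bounded set [C]. So one end of the jump is in
    [C], at bounded distance from every base point because [B] and [C] lie in
    one bounded set, and the other end is at most [s] further away. *)
Lemma switch_near_base (R : realType) (X : metricType R) (I : Type)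
    (A : I -> set X) (B : set X) (b : I -> X) (s : R) :
  (forall t : R, 0 < t -> exists C : set X,
     metric_bounded C /\ separated_family t (fun i => A i `\` C)) ->
  metric_bounded B -> (forall i, B (b i)) -> 0 <= s ->
  exists2 D : R, 0 <= D & forall i j x y, i <> j -> A i x -> A j y ->
    mdist x y <= s -> mdist x (b i) <= D /\ mdist y (b j) <= D.
Proof.
move=> sep bB Bb s0.
(* Separated means at distance at least the scale, hence a scale above [s]. *)
have [C [bC sepC]] := sep (s + 1) (ltr_wpDl s0 ltr01).
have [M MP] := metric_boundedU _ _ _ _ bC bB.
have near k z : C z -> mdist z (b k) <= `|M|.
  by move=> Cz; rewrite (le_trans _ (ler_norm M))// MP//; [left|right].
have near_s k z w : C z -> mdist z w <= s -> mdist w (b k) <= `|M| + s.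
  move=> Cz zw; rewrite (le_trans (metric_triangle w z _))// addrC lerD ?near//.
  by rewrite metric_sym.
have le_s : `|M| <= `|M| + s by rewrite lerDl.
exists (`|M| + s) => [|i j x y ij Ax Ay xy]; first by rewrite addr_ge0.
have [Cx|nCx] := pselect (C x).
  by split; [rewrite (le_trans (near i _ Cx))|exact: near_s Cx xy].
have [Cy|nCy] := pselect (C y).
  split; last by rewrite (le_trans (near j _ Cy)).
  by apply: near_s Cy _; rewrite metric_sym.
have : ((s + 1)%:E <= (mdist x y)%:E)%E.
  apply: (le_trans (sepC i j ij)); apply: ereal_inf_lbound.
  by exists x => //; exists y.
by rewrite lee_fin => /le_trans/(_ xy); rewrite gerDl ler10.
Qed.

Theorem proposition1p4 (R : realType) (X : metricType R) (I : Type)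
    (hI : countable [set: I]) (A : I -> set X)
    (hA : \bigcup_i A i = [set: X])
    (E : completeNormedModType R) (p : R) (p1 : 1 <= p)
    (hsep : forall s : R, 0 < s -> exists C : set X,
       [/\ metric_bounded C,
           (forall i, A i `&` C !=set0) &
           separated_family s (fun i => A i `\` C)])
    (hemb : equi_coarsely_embedded (fun i => set_type (A i)) (norm_metric E)) :
  coarsely_embeds X (norm_metric (pspace E p1)).
Proof.
have [f [f_up f_lo]] := equi_coarsely_embedded_total _ _ _ _ _ hemb.
have /countable_injP[g g_inj'] := hI.
have g_inj i j : g i = g j -> i = j by apply: g_inj'; rewrite in_setT.
have /choice[idx Aidx] : forall x, exists i, A i x.
  by move=> x; have : [set: X] x by []; rewrite -hA => -[i _ Aix]; exists i.
have [B [bB AB _]] := hsep 1 ltr01.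
have /choice[b ABb] : forall i, exists x, (A i `&` B) x by move=> i; exact: AB.
have Ab i : A i (b i) by case: (ABb i).
have Bb i : B (b i) by case: (ABb i).
pose h i x := f i x - f i (b i).
have hB i x y : h i x - h i y = f i x - f i y.
  by rewrite /h opprB addrA subrK.
pose F x : pspace E p1 := single p1 (g (idx x)) (h (idx x) x).
exists (F : X -> norm_metric (pspace E p1)); split=> [s s0|r r0].
- have [D D0 DP] : exists2 D : R, 0 <= D & forall i j x y, i <> j ->
      A i x -> A j y -> mdist x y <= s -> mdist x (b i) <= D /\ mdist y (b j) <= D.
    apply: (switch_near_base _ _ _ _ B) => // t /hsep[C [bC _ sepC]].
    by exists C.
  have [S S0 SP] := f_up _ s0; have [T T0 TP] := f_up _ D0.
  exists (S + (T + T)) => [|_ x x' xx']; first by rewrite !addr_ge0.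
  rewrite -[leLHS]/`|F x - F x'|.
  have [ij|ij] := pselect (idx x = idx x').
    rewrite /F -ij single_sub norm_single hB.
    have Ax' : A (idx x) x' by rewrite ij.
    by rewrite (le_trans (SP _ _ _ (Aidx x) Ax' xx'))// lerDl addr_ge0.
  have [xb x'b] := DP _ _ _ _ ij (Aidx x) (Aidx x') xx'.
  rewrite (le_trans (ler_normB _ _))// !norm_single.
  by rewrite (le_trans (lerD (TP _ _ _ (Aidx x) (Ab _) xb)
    (TP _ _ _ (Aidx x') (Ab _) x'b)))// lerDr.
- have [M MP] := bB; have [S S0 SP] := f_lo _ r0.
  exists (S + (`|M| + S)) => [|_ x x']; first by rewrite !addr_ge0.
  rewrite -[mdist _ _ <= r]/(`|F x - F x'| <= r) => FF.
  have coord n := le_trans (ler_norm_coord p1 (F x - F x') n) FF.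
  have [ij|ij] := pselect (idx x = idx x').
    have Ax' : A (idx x) x' by rewrite ij.
    rewrite (le_trans (SP _ _ _ (Aidx x) Ax' _))// ?lerDl ?addr_ge0//.
    by move: FF; rewrite /F -ij single_sub norm_single hB.
  have gij : (g (idx x) == g (idx x')) = false.
    by apply/eqP => /g_inj.
  have xb : mdist x (b (idx x)) <= S.
    apply: (SP _ _ _ (Aidx x) (Ab _)).
    have := coord (g (idx x)).
    by rewrite pspace_subE /= /single_seq eqxx gij subr0.
  have x'b : mdist x' (b (idx x')) <= S.
    apply: (SP _ _ _ (Aidx x') (Ab _)).
    have := coord (g (idx x')).
    by rewrite pspace_subE /= /single_seq eqxx eq_sym gij sub0r normrN.
  rewrite (le_trans (metric_triangle x (b (idx x)) x'))// lerD//.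
  rewrite (le_trans (metric_triangle _ (b (idx x')) x'))// lerD//.
    by rewrite (le_trans _ (ler_norm M))// MP.
  by rewrite metric_sym.
Qed.
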